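(* For every integer $n\ge 3$, the number of spanning trees of the Cartesian product graph $C_4\times C_n$ equals $$2^7 3^2\, n\, e_{n/2}^4 f_{n/2}^2=\frac{n}{4^{n+1}}\left((\sqrt{3}+1)^{n}-(\sqrt{3}-1)^{n}\right)^4\left((\sqrt{2}+1)^{n}-(\sqrt{2}-1)^{n}\right)^2.$$
   Context: $C_n$ is the cycle on $n$ vertices and $C_4\times C_n$ the Cartesian product graph (vertices $(u,v)$ with $(u_1,v_1)\sim(u_2,v_2)$ iff $u_1=u_2$ and $v_1\sim v_2$, or $u_1\sim u_2$ and $v_1=v_2$). For a positive integer $m$ let $\alpha(m)=\frac{m+2+\sqrt{m^2+4m}}{2}$, $\beta(m)=\frac{m+2-\sqrt{m^2+4m}}{2}$ and, for real $p$, $u_p(m)=\frac{\alpha(m)^p-\beta(m)^p}{\alpha(m)-\beta(m)}$ (positive real powers). Set $e_p=u_p(2)$, $f_p=u_p(4)$; when $n$ is odd, $e_{n/2},f_{n/2}$ are these real numbers with half-integer index. *)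

(* Defs.v *)
From mathcomp Require Import all_boot all_order all_algebra.
From mathcomp Require Import boolp reals exp.

Set Implicit Arguments.
Unset Strict Implicit.
Unset Printing Implicit Defensive.

Import Order.TTheory GRing.Theory Num.Theory.

(* A finite simple graph is given by its vertex set [T : finType] and its
   adjacency relation [e : rel T], symmetric and irreflexive. *)
Section SpanningTrees.
Variable T : finType.

Definition graph_connected (e : rel T) : Prop := forall x y : T, connect e x y.

(* A closed walk x, y, x along a single edge is a [ucycle] of size 2; the cycles
   of a simple graph are the [ucycle]s of size at least 3. *)
Definition graph_acyclic (e : rel T) : Prop :=
  forall c : seq T, ucycle e c -> (size c <= 2)%N.

Definition is_tree (e : rel T) : Prop := graph_connected e /\ graph_acyclic e.

Definition edges (e : rel T) : {set {set T}} :=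
  [set [set p.1; p.2] | p : T * T & e p.1 p.2].

Definition adj_of_edges (F : {set {set T}}) : rel T :=
  fun x y => [set x; y] \in F.

Definition is_spanning_tree (e : rel T) (F : {set {set T}}) : Prop :=
  F \subset edges e /\ is_tree (adj_of_edges F).

Definition num_spanning_trees (e : rel T) : nat :=
  #|[set F : {set {set T}} | `[< is_spanning_tree e F >]]|.

End SpanningTrees.

(* [ordS] is the successor modulo [n]; this is a simple graph for [2 <= n] and
   the cycle on [n] vertices for [3 <= n]. *)
Definition cycle_adj (n : nat) : rel 'I_n :=
  fun i j => (j == ordS i) || (i == ordS j).

Definition cartesian_adj (T1 T2 : finType) (e1 : rel T1) (e2 : rel T2) :
    rel (T1 * T2) :=
  fun u v => (u.1 == v.1) && e2 u.2 v.2 || e1 u.1 v.1 && (u.2 == v.2).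

Local Open Scope ring_scope.

Section Sequences.
Variable R : realType.

Definition alpha (m : nat) : R :=
  (m%:R + 2 + Num.sqrt (m%:R ^+ 2 + 4 * m%:R)) / 2.

Definition beta (m : nat) : R :=
  (m%:R + 2 - Num.sqrt (m%:R ^+ 2 + 4 * m%:R)) / 2.

(* [alpha m] and [beta m] are positive for [0 < m], so [`^] is the usual real
   power here. *)
Definition u_ (p : R) (m : nat) : R :=
  (alpha m `^ p - beta m `^ p) / (alpha m - beta m).

Definition e_ (p : R) : R := u_ p 2.
Definition f_ (p : R) : R := u_ p 4.

End Sequences.

(* Main.v *)
(* For a parent function f : T -> option T, let M_f be the matrix with rows
   [x] - [f x] (or [x] at a root).  Expanding det (a I + b L) along the rows of
   the Laplacian L gives a sum over parent functions of a^#roots b^#edges det M_f,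
   and det M_f is 1 if f is acyclic and 0 otherwise.  With b = 1, the coefficient
   of a in that forest sum counts rooted spanning trees, i.e. |T| times the number
   of spanning trees.
   For C_n with shift matrix P, a = (w - 1)^2 and b = w the matrix is
   (w - P)(w - P^T), so the forest sum is (w^n - 1)^2.  Cancelling (w - 1)^2 and
   putting w = 1 gives n^2 rooted spanning trees; putting w = alpha m, where
   (w - 1)^2 = m w, gives the forest sum D(m) of C_n at a = m, b = 1.
   For C_4 x C_n the matrix is block circulant with determinant
   D(a) D(a + 2)^2 D(a + 4), whose coefficient of a is n^2 D(2)^2 D(4). *)
Require Import Defs.
From mathcomp Require Import all_boot all_order all_algebra.
From mathcomp Require Import fingroup perm mxpoly ring zify.
From mathcomp Require Import boolp reals exp.
Set Implicit Arguments.
Unset Strict Implicit.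
Unset Printing Implicit Defensive.
Import Order.TTheory GRing.Theory Num.Theory.
Local Open Scope ring_scope.

(** * Rooted forests as parent functions, and their relation to spanning trees *)

Section RootedForests.
Variable T : finType.
Implicit Types (f g : {ffun T -> option T}) (e : rel T) (x y z r : T).

(** Acyclicity of a parent function is witnessed by a rank that drops from child to parent; this
    gives direct inductions on depth. *)
Definition ranked_by f (d : T -> nat) :=
  forall x y, f x = Some y -> (d y < d x)%N.

Definition rooted_forest f : bool := `[< exists d, ranked_by f d >].

Definition forest_roots f : {set T} := [set x | f x == None].

Definition parent_edges_in e f := [forall x, forall y, (f x == Some y) ==> e x y].

Definition forest_edges f : {set {set T}} :=
  [set [set p.1; p.2] | p : T * T & f p.1 == Some p.2].

Lemma rooted_forestP f : reflect (exists d, ranked_by f d) (rooted_forest f).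
Proof. exact: asboolP. Qed.

Lemma parent_edges_inP e f :
  reflect (forall x y, f x = Some y -> e x y) (parent_edges_in e f).
Proof.
apply: (iffP forallP) => [H x y fxy | H x].
  by have /forallP/(_ y)/implyP := H x; apply; apply/eqP.
by apply/forallP => y; apply/implyP => /eqP; apply: H.
Qed.

Lemma forest_irrefl f x : rooted_forest f -> f x != Some x.
Proof. by move=> /rooted_forestP[d fd]; apply/eqP => /fd; rewrite ltnn. Qed.

Lemma forest_roots_gt0 f : (0 < #|T|)%N -> rooted_forest f -> (0 < #|forest_roots f|)%N.
Proof.
move=> /card_gt0P[x0 _] /rooted_forestP[d fd].
case: (@arg_minnP T x0 xpredT d) => // x _ xmin.
apply/card_gt0P; exists x; rewrite inE; apply/eqP.
case fx: (f x) => [y|] //; have := fd _ _ fx.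
by rewrite ltnNge xmin.
Qed.

(** [S] collects the vertices whose ancestor chain never reaches a root. If it were empty, the
    length of the chain would be a rank. The condition on [S] is an equality so that its indicator
    becomes a kernel vector later. *)
Lemma not_forest_closed f : ~~ rooted_forest f ->
  exists2 S : {set T}, S != set0
    & forall x, (x \in S) = if f x is Some y then y \in S else false.
Proof.
pose it k x := iter k (obind f) (Some x).
have itS k x : it k.+1 x = if f x is Some y then it k y else None.
  rewrite /it iterSr /=; case: (f x) => //=.
  by elim: k => //= k ->.
move=> nf; exists [set x | `[< forall k, it k x <> None >]].
  apply/eqP => S0; move/rooted_forestP: nf; apply.
  have H x : exists k, it k x == None.
    have: x \notin [set x | `[< forall k, it k x <> None >]] by rewrite S0 inE.
    rewrite inE; move/asboolP/existsNP => [k /contrapT kx].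
    by exists k; apply/eqP.
  exists (fun x => ex_minn (H x)) => x y fxy.
  (* The minimum is never 0, since [it 0 x] is [Some x]. *)
  case: (ex_minnP (H x)) => -[|k]; first by [].
  rewrite itS fxy => ky _; case: ex_minnP => m _ /(_ _ ky).
  by rewrite ltnS.
move=> x; rewrite inE; case fx: (f x) => [y|].
  rewrite inE; apply: asbool_equiv_eq; split => H k.
    by have := H k.+1; rewrite itS fx.
  by case: k => // k; rewrite itS fx; apply: H.
by apply/negbTE/negP => /asboolP/(_ 1%N); rewrite itS fx.
Qed.

Lemma set2_eq x y a b :
  [set x; y] = [set a; b] -> (x = a /\ y = b) \/ (x = b /\ y = a).
Proof.
move=> E.
have: x \in [set a; b] by rewrite -E set21.
have: y \in [set a; b] by rewrite -E set22.
have: a \in [set x; y] by rewrite E set21.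
have: b \in [set x; y] by rewrite E set22.
by rewrite !in_set2; do 4![case/orP=> /eqP ?]; subst; auto.
Qed.

Lemma adj_forest_edges f x y :
  adj_of_edges (forest_edges f) x y = (f x == Some y) || (f y == Some x).
Proof.
apply/imsetP/orP => [[[a b]] | []] /=.
- rewrite inE /= => fab /set2_eq[[-> ->]|[-> ->]]; by [left | right].
- by move=> fxy; exists (x, y); rewrite ?inE.
- by move=> fyx; exists (y, x); rewrite ?inE //= setUC.
Qed.

Definition tree_toward r f :=
  rooted_forest f /\ forall x, f x = None <-> x = r.

Lemma adj_of_edgesC (F : {set {set T}}) : symmetric (adj_of_edges F).
Proof. by move=> x y; rewrite /adj_of_edges setUC. Qed.

Lemma tree_toward_connected r f :
  tree_toward r f -> graph_connected (adj_of_edges (forest_edges f)).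
Proof.
move=> [/rooted_forestP[d fd] froot].
suff H x : connect (adj_of_edges (forest_edges f)) x r.
  move=> x y; apply: connect_trans (H x) _.
  by rewrite (sym_connect_sym (adj_of_edgesC _)).
have [k] := ubnP (d x); elim: k x => // k IH x dx.
case fx: (f x) => [y|]; last by rewrite (froot x).1.
apply: connect_trans (IH y _); last by apply: leq_trans (fd _ _ fx) _.
by apply: connect1; rewrite adj_forest_edges fx eqxx.
Qed.

(* At a vertex of largest depth on a cycle both neighbours have smaller depth,
   hence both are its parent. *)
Lemma forest_edges_acyclic f :
  rooted_forest f -> graph_acyclic (adj_of_edges (forest_edges f)).
Proof.
move=> /rooted_forestP[d fd] c cc; rewrite leqNgt; apply/negP => c3.
case: c cc c3 => // x0 c cc c3.
case: (@arg_maxnP T x0 (mem (x0 :: c)) d) => [|x xc xmax]; first exact: mem_head.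
have [i s rots] := rot_to xc.
have ucs : ucycle (adj_of_edges (forest_edges f)) (x :: s).
  by rewrite -rots rot_ucycle.
have mems y : y \in x :: s -> (d y <= d x)%N.
  by rewrite -rots mem_rot; apply: xmax.
have szs : (2 < size (x :: s))%N by rewrite -rots size_rot.
have parent y : y \in x :: s -> adj_of_edges (forest_edges f) x y ->
    f x = Some y.
  move=> /mems yx; rewrite adj_forest_edges => /orP[/eqP//|/eqP/fd].
  by rewrite ltnNge yx.
case: s {rots mems} ucs szs parent => [|y s] //.
case/lastP: s => [|s z] // + _ parent.
rewrite /ucycle /= rcons_path last_rcons => /andP[/and3P[xy _ zx]].
move=> /and3P[_ ynz _].
have fxy : f x = Some y by apply: parent => //; rewrite !inE eqxx orbT.
have fxz : f x = Some z.
  apply: parent; last by rewrite adj_of_edgesC.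
  by rewrite !inE mem_rcons inE eqxx !orbT.
by move: ynz; rewrite mem_rcons inE;
  case: (etrans (esym fxy) fxz) => ->; rewrite eqxx.
Qed.

(** Induction on depth in [f]: if [g] reversed the edge from [x] to its parent [y], the shallower
    vertex [y] would have parent [x] in [f] as well, against the rank. *)
Lemma forest_edges_inj r f g : tree_toward r f -> tree_toward r g ->
  forest_edges f = forest_edges g -> f = g.
Proof.
move=> [/rooted_forestP[d fd] fr] [/rooted_forestP[d' gd] gr] E.
apply/ffunP => x; have [k] := ubnP (d x); elim: k x => // k IH x dx.
case fx: (f x) => [y|]; last by apply/esym/gr/fr.
have yk : (d y < k)%N by apply: leq_trans (fd _ _ fx) _.
have: adj_of_edges (forest_edges g) x y.
  by rewrite -E adj_forest_edges fx eqxx.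
rewrite adj_forest_edges => /orP[/eqP//|/eqP gy].
have := fd _ _ fx; rewrite ltnNge ltnW // fd //.
by rewrite IH.
Qed.

Lemma tree_toward_spanning r e f : tree_toward r f -> parent_edges_in e f ->
  is_spanning_tree e (forest_edges f).
Proof.
move=> tf /parent_edges_inP fe; split; last first.
  split; first exact: tree_toward_connected tf.
  by apply: forest_edges_acyclic; case: tf.
apply/subsetP => _ /imsetP[[x y] + ->]; rewrite inE /= => /eqP/fe exy.
by apply/imsetP; exists (x, y); rewrite ?inE.
Qed.

(* Parents are chosen along shortest paths to [r]. *)
Lemma connected_tree_toward r e : graph_connected e ->
  exists2 f, tree_toward r f & parent_edges_in e f.
Proof.
move=> ce.
pose P x k := `[< exists p, [/\ path e x p, last x p = r & size p = k] >].
have H x : exists k, P x k.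
  have /connectP[p ep lp] := ce x r.
  by exists (size p); apply/asboolP; exists p.
pose d x := ex_minn (H x).
have dr : d r = 0%N.
  rewrite /d; case: ex_minnP => m _ /(_ 0%N).
  by rewrite leqn0 => H0; apply/eqP/H0/asboolP; exists [::].
have step x : x != r -> exists y, e x y && (d y < d x)%N.
  move=> xr; rewrite {2}/d; case: ex_minnP => m /asboolP[[|y p] []] /=.
    by move=> _ E; rewrite E eqxx in xr.
  move=> /andP[exy ep] lp <- _; exists y; rewrite exy ltnS /d.
  by case: ex_minnP => k _; apply; apply/asboolP; exists p.
pose f := [ffun x => if x == r then None else [pick y | e x y && (d y < d x)%N]].
have fP x y : f x = Some y -> e x y && (d y < d x)%N.
  by rewrite ffunE; case: ifP => // _; case: pickP => // z Hz [<-].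
exists f; last by apply/parent_edges_inP => x y /fP/andP[].
split; first by apply/rooted_forestP; exists d => x y /fP/andP[].
move=> x; rewrite ffunE; case: eqVneq => // xr; case: pickP => [y _|no]; split=> //.
  by move=> E; rewrite E eqxx in xr.
by have [y] := step _ xr; rewrite no.
Qed.

(** A tree of parents chosen inside [F] already exhausts [F]: any further edge would close a tree
    path into a cycle of [F]. *)
Lemma spanning_tree_forest_edges r e F : irreflexive e -> symmetric e ->
    is_spanning_tree e F ->
  exists f, [/\ tree_toward r f, parent_edges_in e f & forest_edges f = F].
Proof.
move=> ie se [Fe [Fc Fa]].
have adjF x y : adj_of_edges F x y -> e x y.
  move=> /(subsetP Fe)/imsetP[[a b]]; rewrite inE /= => eab.
  by move=> /set2_eq[[-> ->]|[-> ->]] //; rewrite se.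
have [f tf fF] := connected_tree_toward r Fc.
have sub : forest_edges f \subset F.
  apply/subsetP => _ /imsetP[[x y] + ->]; rewrite inE /= => /eqP.
  exact: (parent_edges_inP _ _ fF).
exists f; split => //.
  by apply/parent_edges_inP => x y /(parent_edges_inP _ _ fF)/adjF.
apply/eqP; rewrite eqEsubset sub; apply/subsetP => A FA.
have /imsetP[[x y] + EA] := subsetP Fe _ FA; rewrite inE /= => exy.
rewrite {}EA in FA *; apply/contraT => nxy.
have /connectP[p ep lp] := tree_toward_connected tf x y.
case/shortenP: ep lp => q eq uq _ lq.
(* The tree path from [x] to [y] followed by the edge back to [x] is a cycle of [F], so the path is
   a single edge and [x], [y] are already joined in the tree. *)
have: (size (x :: q) <= 2)%N.
  apply: Fa; rewrite /ucycle uq andbT /= rcons_path -lq adj_of_edgesC.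
  rewrite [adj_of_edges F x y]FA andbT.
  by apply: sub_path eq => a b; apply: (subsetP sub).
case: q eq lq {uq} => [|z [|? ?]] //=.
  by move=> _ yx; rewrite yx ie in exy.
by rewrite andbT => xz zy; move: nxy; rewrite zy -/(adj_of_edges _ _ _) xz.
Qed.

Definition tree_towardb r f := rooted_forest f && (forest_roots f == [set r]).

Lemma tree_towardP r f : reflect (tree_toward r f) (tree_towardb r f).
Proof.
apply: (iffP andP) => -[ff H]; split=> //.
  move=> x; move/eqP/setP/(_ x): H; rewrite !inE.
  by case: eqP => [-> | ?]; case: eqP => // ?.
apply/eqP/setP => x; rewrite !inE.
by apply/eqP/eqP => /H.
Qed.

Lemma card_trees_toward r e : irreflexive e -> symmetric e ->
  #|[set f | tree_towardb r f && parent_edges_in e f]| = num_spanning_trees e.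
Proof.
move=> ie se; rewrite -(@card_in_imset _ _ forest_edges) => [|f g]; last first.
  rewrite !inE => /andP[/tree_towardP tf _] /andP[/tree_towardP tg _].
  exact: forest_edges_inj tf tg.
apply: eq_card => F; rewrite !inE; apply/imsetP/asboolP => [[f + ->]|].
  rewrite inE => /andP[/tree_towardP tf fe].
  exact: tree_toward_spanning tf fe.
move=> /(spanning_tree_forest_edges r ie se)[f [tf fe <-]].
by exists f => //; rewrite inE fe andbT; apply/tree_towardP.
Qed.

(** Double counting over the choice of root: a forest with one root is counted exactly at that
    root. *)
Lemma card_rooted_spanning_trees e : irreflexive e -> symmetric e ->
  #|[set f | [&& rooted_forest f, parent_edges_in e f & #|forest_roots f| == 1%N]]|
    = (#|T| * num_spanning_trees e)%N.
Proof.
move=> ie se; rewrite -sum1_card.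
transitivity (\sum_(r : T) \sum_(f | tree_towardb r f && parent_edges_in e f) 1)%N.
  rewrite [RHS](exchange_big_dep (fun f => [&& rooted_forest f, parent_edges_in e f
      & #|forest_roots f| == 1%N])) /=; last first.
    by move=> r f _ /andP[/andP[-> /eqP->] ->]; rewrite cards1.
  rewrite (eq_bigl (fun f => [&& rooted_forest f, parent_edges_in e f
      & #|forest_roots f| == 1%N])); last by move=> f; rewrite inE.
  apply: eq_bigr => f /and3P[ff fe /cards1P[r fr]].
  rewrite (eq_bigl (pred1 r)) ?big_pred1_eq // => s.
  rewrite /tree_towardb ff fe fr andbT /= eqEsubset !sub1set !inE.
  by rewrite eq_sym andbb.
rewrite -sum_nat_const; apply: eq_bigr => r _.
by rewrite -(card_trees_toward r ie se) -sum1_card; apply: eq_bigl => f; rewrite inE.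
Qed.

End RootedForests.

(** * A weighted matrix-forest theorem *)

Section MatrixForest.
Variables (R : comNzRingType) (T : finType) (N : nat) (h : 'I_N -> T).
Hypothesis hbij : bijective h.
Implicit Types f : {ffun T -> option T}.

Definition parent_mx f : 'M[R]_N :=
  \matrix_(i, j) ((h i == h j)%:R - (f (h i) == Some (h j))%:R).

Lemma det_parent_mx_forest f : rooted_forest f -> \det (parent_mx f) = 1.
Proof.
move=> ff; have /rooted_forestP[d fd] := ff; have hi := bij_inj hbij.
have diag i : parent_mx f i i = 1.
  by rewrite mxE eqxx (negbTE (forest_irrefl _ ff)) subr0.
rewrite /determinant (bigD1 (1%g : 'S_N)) //= odd_perm1 expr0 mul1r.
rewrite big1 => [|i _]; last by rewrite perm1 diag.
rewrite big1 ?addr0 // => s s1.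
(* A permutation supported on the matrix moves the parent of every point that
   it moves, which is impossible for a moved point of least depth. *)
have [/existsP[i /eqP si0]|] := boolP [exists i, parent_mx f i (s i) == 0].
  by rewrite (bigD1 i) //= si0 mul0r mulr0.
rewrite negb_exists => /forallP nz.
have [i0 i0P] : exists i, s i != i.
  apply/existsP; apply: contraNT s1; rewrite negb_exists => /forallP H.
  by apply/eqP/permP => i; rewrite perm1; apply/eqP; have := H i; rewrite negbK.
case: (@arg_minnP _ i0 (fun i => s i != i) (fun i => d (h i)) i0P) => i si imin.
have := nz i; rewrite mxE (inj_eq hi) [i == s i]eq_sym (negbTE si) sub0r oppr_eq0.
have [fsi _|_] := f (h i) =P _; last by rewrite eqxx.
have := fd _ _ fsi; rewrite ltnNge imin //.
by rewrite (inj_eq perm_inj).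
Qed.

(* The indicator of a set closed under [f] is in the kernel. *)
Lemma det_parent_mx_not_forest f : ~~ rooted_forest f -> \det (parent_mx f) = 0.
Proof.
move=> /not_forest_closed[S /set0Pn[x xS] Sf].
have [h' hK h'K] := hbij.
pose v : 'cV[R]_N := \col_i (h i \in S)%:R.
have Mv : parent_mx f *m v = 0.
  apply/colP => i; rewrite !mxE.
  under eq_bigr do rewrite !mxE mulrBl.
  rewrite sumrB (bigD1 i) //= eqxx mul1r big1 ?addr0 => [|j ji]; last first.
    by rewrite (inj_eq (bij_inj hbij)) eq_sym (negbTE ji) mul0r.
  rewrite Sf; case: (f (h i)) => [y|]; last first.
    by rewrite big1 ?subr0 // => j _; rewrite mul0r.
  rewrite (bigD1 (h' y)) //= h'K eqxx mul1r big1 ?addr0 ?subrr // => j jy.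
  case: eqP => [[yj]|_]; last by rewrite mul0r.
  by move: jy; rewrite yj hK eqxx.
have := congr1 (mulmx (\adj (parent_mx f))) Mv.
rewrite mulmxA mul_adj_mx mul_scalar_mx mulmx0 => /colP/(_ (h' x)).
by rewrite !mxE h'K xS mulr1.
Qed.

Lemma det_parent_mx f : \det (parent_mx f) = (rooted_forest f)%:R.
Proof.
have [ff|nf] := boolP (rooted_forest f); first exact: det_parent_mx_forest.
exact: det_parent_mx_not_forest.
Qed.

(** The row of [x] is a combination, over the possible parents [o] of [x], of rows of parent
    matrices. Multilinearity leaves one determinant per parent function, equal to 0 or 1. *)
Theorem matrix_forest (w : T -> option T -> R) :
  \det (\matrix_(i, j) \sum_o w (h i) o *
          ((h i == h j)%:R - (o == Some (h j))%:R))
  = \sum_(f : {ffun T -> option T} | rooted_forest f) \prod_x w x (f x).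
Proof.
have [h' hK h'K] := hbij.
rewrite [RHS]big_mkcond /=.
transitivity (\sum_(f : {ffun T -> option T})
    (\prod_x w x (f x)) * \det (parent_mx f)); last first.
  by apply: eq_bigr => f _; rewrite det_parent_mx mulrb;
    case: ifP => _; rewrite ?mulr1 ?mulr0.
(* Multilinearity is carried out inside the Leibniz formula: for each permutation, the product of
   row sums is distributed over parent functions. *)
under [RHS]eq_bigr do rewrite big_distrr /=.
rewrite exchange_big /=; apply: eq_bigr => s _.
under eq_bigr do rewrite mxE.
rewrite (reindex h') /=; last by exists h => ? _; rewrite ?hK ?h'K.
rewrite bigA_distr_bigA big_distrr /=; apply: eq_bigr => f _.
rewrite mulrCA; congr (_ * _).
rewrite big_split /=; congr (_ * _).
  by apply: eq_bigr => x _; rewrite h'K.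
rewrite [RHS](reindex h') /=; last by exists h => ? _; rewrite ?hK ?h'K.
by apply: eq_bigr => x _; rewrite mxE !h'K.
Qed.

End MatrixForest.

(** * Laplacian determinants as generating functions of forests *)

Section Laplacian.
Variables (R : comNzRingType) (T : finType) (e : rel T).
Variables (N : nat) (h : 'I_N -> T).
Hypothesis hbij : bijective h.

(** Each vertex other than a root owns one edge, so the exponent of [b] is the number of edges. *)
Definition forest_sum (a b : R) : R :=
  \sum_(f : {ffun T -> option T} | rooted_forest f && parent_edges_in e f)
     a ^+ #|forest_roots f| * b ^+ (#|T| - #|forest_roots f|).

(** A root gets weight [a] and a parent [z] of [x] gets [b] or 0 according to adjacency, so parent
    functions leaving the graph contribute nothing. *)
Lemma det_laplacian (a b : R) :
  \det (\matrix_(i, j) (a * (h i == h j)%:R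
      + b * \sum_z (e (h i) z)%:R * ((h i == h j)%:R - (z == h j)%:R)))
  = forest_sum a b.
Proof.
pose w x o : R := if o is Some z then b * (e x z)%:R else a.
rewrite /forest_sum big_mkcondr /=.
transitivity (\sum_(f : {ffun T -> option T} | rooted_forest f)
   \prod_x w x (f x)).
  rewrite -(matrix_forest hbij); congr (\det _); apply/matrixP => i j.
  rewrite !mxE (bigD1 None) //= subr0; congr (_ + _).
  rewrite mulr_sumr; rewrite (reindex_omap Some id) /=; last by case.
  apply: eq_big => [z|z _]; first by rewrite eqxx.
  by rewrite mulrA.
apply: eq_bigr => f ff; case: ifPn => [/parent_edges_inP fe|].
  rewrite (bigID (mem (forest_roots f))) /=; congr (_ * _).
    rewrite (eq_bigr (fun=> a)) ?prodr_const // => x.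
    by rewrite inE => /eqP->.
  rewrite (eq_bigr (fun=> b)) => [|x]; last first.
    by rewrite inE; case fx: (f x) => [y|] // _; rewrite /= fe // mulr1.
  rewrite prodr_const; congr (_ ^+ _).
  by rewrite -[in RHS](setCK (forest_roots f)) -cardsCs -cardsE;
    apply: eq_card => x; rewrite !inE.
rewrite negb_forall => /existsP[x]; rewrite negb_forall => /existsP[y].
rewrite negb_imply => /andP[/eqP fxy nexy].
by rewrite (bigD1 x) //= fxy /= (negbTE nexy) mulr0 mul0r.
Qed.

End Laplacian.

(** * Extracting the number of rooted spanning trees from the forest sum *)

Section ForestSum.
Variables (T : finType) (e : rel T).

Lemma forest_sum_homog (R : comNzRingType) (c a b : R) :
  forest_sum e (c * a) (c * b) = c ^+ #|T| * forest_sum e a b.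
Proof.
rewrite mulr_sumr; apply: eq_bigr => f _.
by rewrite !exprMn mulrACA -exprD subnKC ?max_card.
Qed.

Lemma rmorph_forest_sum (R S : comNzRingType) (phi : {rmorphism R -> S}) a b :
  phi (forest_sum e a b) = forest_sum e (phi a) (phi b).
Proof.
rewrite rmorph_sum /=; apply: eq_bigr => f _.
by rewrite rmorphM !rmorphXn.
Qed.

Definition num_rooted_spanning_trees : nat :=
  #|[set f | [&& rooted_forest f, parent_edges_in e f & #|forest_roots f| == 1%N]]|.

Lemma coef0_forest_sum (R : comNzRingType) : (0 < #|T|)%N ->
  (forest_sum e 'X 1 : {poly R})`_0 = 0.
Proof.
move=> T0; rewrite coef_sum big1 // => f /andP[ff _].
rewrite expr1n mulr1 coefXn; have := forest_roots_gt0 T0 ff.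
by case: #|_|.
Qed.

Lemma coef1_forest_sum (R : comNzRingType) :
  (forest_sum e 'X 1 : {poly R})`_1 = num_rooted_spanning_trees%:R.
Proof.
rewrite coef_sum /num_rooted_spanning_trees -sum1_card natr_sum.
rewrite [RHS]big_mkcond [LHS]big_mkcond /=.
apply: eq_bigr => f _; rewrite inE andbA expr1n mulr1 coefXn eq_sym.
by case: andP => //= _; case: eqP.
Qed.

(** Every forest has a root, so each term contains the factor [('X - 1) ^+ 2]. After it is
    cancelled, evaluation at 1 kills the forests with several roots. *)
Lemma num_rooted_forest_sum_sqr (R : idomainType) (S : {poly R}) : (0 < #|T|)%N ->
  forest_sum e (('X - 1) ^+ 2) 'X = (('X - 1) * S) ^+ 2 ->
  num_rooted_spanning_trees%:R = S.[1] ^+ 2.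
Proof.
move=> T0; rewrite /forest_sum exprMn.
rewrite (eq_bigr (fun f => ('X - 1) ^+ 2 * ((('X - 1) ^+ 2) ^+ #|forest_roots f|.-1
    * 'X ^+ (#|T| - #|forest_roots f|)))) => [|f /andP[ff _]]; last first.
  by rewrite mulrA -exprS prednK // forest_roots_gt0.
have X1 : 'X - 1 != 0 :> {poly R} by rewrite -polyC1 polyXsubC_eq0.
rewrite -mulr_sumr => /(mulfI (expf_neq0 2 X1)) /(congr1 (horner^~ 1)).
rewrite horner_exp horner_sum => <-.
rewrite /num_rooted_spanning_trees -sum1_card natr_sum.
rewrite [RHS]big_mkcond [LHS]big_mkcond /=.
apply: eq_bigr => f _; rewrite inE andbA.
case: (boolP (_ && parent_edges_in e f)) => //= /andP[ff _].
rewrite !hornerE subrr expr0n /= expr0n expr1n mulr1.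
have := forest_roots_gt0 T0 ff.
by case: #|_| => [|[|k]].
Qed.

End ForestSum.

(** * The Laplacian of the cycle *)

Lemma eq_ordS n (i j : 'I_n) : (i == ordS j) = (j == ord_pred i).
Proof. by rewrite -(inj_eq (@ord_pred_inj n)) ordSK eq_sym. Qed.

(** This makes a sum over neighbours on the cycle have two separate terms; for [n = 2] both
    neighbours coincide. *)
Lemma ord_pred_neq_ordS n (i : 'I_n) : (3 <= n)%N -> ord_pred i != ordS i.
Proof.
move=> n3; rewrite eq_sym -eq_ordS -val_eqE /=; case: i => i li /=.
have [E|ne] := eqVneq i.+1 n; first by rewrite E modnn modn_small; lia.
rewrite (@modn_small i.+1); last by lia.
have [E|ne2] := eqVneq i.+2 n; first by rewrite E modnn; lia.
by rewrite modn_small; lia.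
Qed.

Section CycleMatrix.
Variables (R : comNzRingType) (n : nat).

Definition shift_mx : 'M[R]_n := \matrix_(i, j) (j == ordS i)%:R.

Lemma shift_mx_orth : shift_mx *m shift_mx^T = 1%:M.
Proof.
apply/matrixP => i j; rewrite !mxE (bigD1 (ordS i)) //= big1 => [|k /negbTE ki].
  by rewrite !mxE eqxx mul1r addr0 (inj_eq (@ordS_inj n)).
by rewrite !mxE ki mul0r.
Qed.

(** The cyclic shift is the companion matrix of ['X^n - 1]. *)
Lemma char_poly_shift_mx : (0 < n)%N -> char_poly shift_mx = 'X^n - 1.
Proof.
move=> n0; have mon : ('X^n - 1 : {poly R}) \is monic by exact: monicXnsubC.
rewrite -[RHS](companionmxK mon).
have sz : (size ('X^n - 1 : {poly R})).-1 = n by rewrite size_XnsubC.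
(* The companion matrix has dimension [(size p).-1], equal to [n] only propositionally, so the
   comparison is made in a variable dimension [d]. *)
suff H d (A : 'M[R]_d) (E : d = n) :
    (forall i j, A i j = if i == d.-1 :> nat then - ('X^n - 1 : {poly R})`_j
                         else (i.+1 == j :> nat)%:R) ->
    char_poly A = char_poly shift_mx.
  by rewrite -(H _ (companionmx ('X^n - 1 : {poly R})) sz) // => i j; rewrite mxE.
subst d => HA; congr char_poly; apply/matrixP => i j.
rewrite HA mxE -val_eqE /= coefB coefXn coef1 (ltn_eqF (ltn_ord j)) sub0r opprK.
have [->|ni] := eqVneq (i : nat) n.-1; first by rewrite prednK // modnn.
rewrite modn_small 1?eq_sym //; have := ltn_ord i; lia.
Qed.

Lemma det_scalar_sub_shift_mx (w : R) : (0 < n)%N ->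
  \det (w%:M - shift_mx) = w ^+ n - 1.
Proof.
move=> n0; have := congr1 (horner_eval w) (char_poly_shift_mx n0).
rewrite /char_poly /char_poly_mx -det_map_mx /horner_eval !hornerE => <-; congr (\det _).
by apply/matrixP => i j; rewrite !mxE /= /horner_eval hornerD hornerN hornerMn
  hornerX hornerC.
Qed.

Lemma det_cycle_mx (w : R) : (0 < n)%N ->
  \det ((w ^+ 2 + 1)%:M - w *: (shift_mx + shift_mx^T)) = (w ^+ n - 1) ^+ 2.
Proof.
move=> n0; transitivity (\det ((w%:M - shift_mx) *m (w%:M - shift_mx^T))).
  congr (\det _); rewrite mulmxBl !mulmxBr shift_mx_orth -!scalar_mxM.
  rewrite mul_mx_scalar mul_scalar_mx scalerDr raddfD /= -expr2 !opprD opprK.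
  by rewrite -!addrA; congr (_ + _); rewrite addrCA addrA addrC addrA.
rewrite det_mulmx expr2; congr (_ * _); first exact: det_scalar_sub_shift_mx.
by rewrite -det_tr linearB /= trmxK tr_scalar_mx det_scalar_sub_shift_mx.
Qed.

Hypothesis n3 : (3 <= n)%N.

Lemma sum_cycle_adj (g : 'I_n -> R) i :
  \sum_z (@cycle_adj n i z)%:R * g z = g (ordS i) + g (ord_pred i).
Proof.
rewrite (bigD1 (ordS i)) //= (bigD1 (ord_pred i)) ?ord_pred_neq_ordS //=.
rewrite big1 ?addr0 => [|z].
  by rewrite /cycle_adj eqxx ord_predK eqxx orbT !mul1r.
move=> /andP[zS zp].
by rewrite /cycle_adj (negbTE zS) eq_ordS (negbTE zp) mul0r.
Qed.

Lemma forest_sum_cycle (a b : R) :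
  forest_sum (@cycle_adj n) a b = \det ((a + b *+ 2)%:M - b *: (shift_mx + shift_mx^T)).
Proof.
rewrite -(@det_laplacian _ _ _ n id); last by exists id.
congr (\det _); apply/matrixP => i j; rewrite !mxE sum_cycle_adj.
rewrite [ordS i == j]eq_sym [ord_pred i == j]eq_sym -eq_ordS -mulr_natr; ring.
Qed.

End CycleMatrix.

Lemma cycle_adj_sym n : symmetric (@cycle_adj n).
Proof. by move=> i j; rewrite /cycle_adj orbC. Qed.

Lemma cycle_adj_irrefl n : (2 <= n)%N -> irreflexive (@cycle_adj n).
Proof.
move=> n2 i; rewrite /cycle_adj orbb -val_eqE /=; apply/negbTE.
have [E|lt] := eqVneq i.+1 n; first by rewrite E modnn; lia.
by rewrite modn_small; have := ltn_ord i; lia.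
Qed.

Lemma forest_sum_cycle_sqr (R : comNzRingType) n (w : R) : (3 <= n)%N ->
  forest_sum (@cycle_adj n) ((w - 1) ^+ 2) w = (w ^+ n - 1) ^+ 2.
Proof.
move=> n3; rewrite forest_sum_cycle // -det_cycle_mx; last by lia.
by congr (\det (_%:M - _)); ring.
Qed.

Lemma num_rooted_spanning_trees_cycle n : (3 <= n)%N ->
  num_rooted_spanning_trees (@cycle_adj n) = (n ^ 2)%N.
Proof.
move=> n3; apply/eqP; rewrite -(eqr_nat int).
(* The geometric sum is the quotient of ['X^n - 1] by ['X - 1], and its value at 1 is [n]. *)
rewrite (@num_rooted_forest_sum_sqr _ _ _ (\sum_(i < n) 'X^i)); last 2 first.
- by rewrite card_ord; lia.
- by rewrite forest_sum_cycle_sqr // -subrX1.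
rewrite horner_sum (eq_bigr (fun=> 1)) => [|i _]; last by rewrite hornerXn expr1n.
by rewrite sumr_const card_ord natrX.
Qed.

(** * Adjacency in Cartesian products *)

Section CartesianProduct.
Variables (T1 T2 : finType) (e1 : rel T1) (e2 : rel T2).

Lemma cartesian_adj_sym :
  symmetric e1 -> symmetric e2 -> symmetric (cartesian_adj e1 e2).
Proof.
move=> s1 s2 u v.
by rewrite /cartesian_adj s1 s2 [u.1 == _]eq_sym [u.2 == _]eq_sym.
Qed.

Lemma cartesian_adj_irrefl :
  irreflexive e1 -> irreflexive e2 -> irreflexive (cartesian_adj e1 e2).
Proof. by move=> i1 i2 u; rewrite /cartesian_adj i1 i2 andbF. Qed.

Lemma sum_cartesian_adj (R : pzRingType) (g : T1 * T2 -> R) u :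
  irreflexive e1 ->
  \sum_z (cartesian_adj e1 e2 u z)%:R * g z
    = \sum_z (e2 u.2 z)%:R * g (u.1, z) + \sum_z (e1 u.1 z)%:R * g (z, u.2).
Proof.
move=> i1; case: u => x y /=.
have pairE (F : T1 * T2 -> R) : \sum_z F z = \sum_a \sum_b F (a, b).
  by rewrite pair_bigA; apply: eq_bigr => -[].
(* Irreflexivity of [e1] makes the two kinds of edges exclusive, so the indicator of the disjunction
   is a sum. *)
have adjE a b : (cartesian_adj e1 e2 (x, y) (a, b))%:R
    = ((x == a) && e2 y b)%:R + (e1 x a && (y == b))%:R :> R.
  rewrite /cartesian_adj /=; have [<-|_] := eqVneq x a; last by rewrite add0r.
  by rewrite i1 orbF addr0.
transitivity (\sum_a \sum_b (((x == a) && e2 y b)%:R * g (a, b)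
    + (e1 x a && (y == b))%:R * g (a, b))).
  rewrite pairE; apply: eq_bigr => a _; apply: eq_bigr => b _.
  by rewrite adjE mulrDl.
under [LHS]eq_bigr do rewrite big_split /=.
rewrite big_split /=; congr (_ + _).
  rewrite (bigD1 x) //= [X in _ + X]big1 ?addr0 => [|a /negbTE ax].
    by apply: eq_bigr => b _; rewrite eqxx.
  by apply: big1 => b _; rewrite eq_sym ax mul0r.
apply: eq_bigr => a _; rewrite (bigD1 y) //= big1 ?addr0 => [|b /negbTE ay].
  by rewrite eqxx andbT.
by rewrite eq_sym ay andbF mul0r.
Qed.

End CartesianProduct.

(** [U] adds the second block row to the first and [V] subtracts the first block column from the
    second. Both have determinant 1, and the result is block lower triangular. *)
Lemma det_block_mx_circulant (R : comNzRingType) n (A B : 'M[R]_n) :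
  \det (block_mx A B B A) = \det (A + B) * \det (A - B).
Proof.
pose U : 'M[R]_(n + n) := block_mx 1%:M 1%:M 0 1%:M.
pose V : 'M[R]_(n + n) := block_mx 1%:M (- 1%:M) 0 1%:M.
have dU : \det U = 1 by rewrite det_ublock !det1 mulr1.
have dV : \det V = 1 by rewrite det_ublock !det1 mulr1.
transitivity (\det (U *m block_mx A B B A *m V)).
  by rewrite !det_mulmx dU dV mul1r mulr1.
rewrite !mulmx_block !(mul1mx, mulmx1, mulmx0, mul0mx, mulmxN, addr0, add0r).
by rewrite [B + A]addrC addNr [- B + A]addrC det_lblock.
Qed.

(** * Block diagonalization for the product of a 4-cycle and a cycle *)

Section C4Product.
Variables (R : comNzRingType) (n : nat).
Hypothesis n3 : (3 <= n)%N.

Let v0 : 'I_4 := @Ordinal 4 0 isT.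
Let v1 : 'I_4 := @Ordinal 4 1 isT.
Let v2 : 'I_4 := @Ordinal 4 2 isT.
Let v3 : 'I_4 := @Ordinal 4 3 isT.

(** Nested halves list the four copies of the cycle in order, which exposes a 2 by 2 block circulant
    of 2 by 2 blocks. *)
Definition block_vertex (k : 'I_(n + n + (n + n))) : 'I_4 * 'I_n :=
  match split k with
  | inl k => match split k with inl i => (v0, i) | inr i => (v1, i) end
  | inr k => match split k with inl i => (v2, i) | inr i => (v3, i) end
  end.

Lemma block_vertexE i :
  (block_vertex (lshift _ (lshift _ i)) = (v0, i)) *
  (block_vertex (lshift _ (rshift _ i)) = (v1, i)) *
  (block_vertex (rshift _ (lshift _ i)) = (v2, i)) *
  (block_vertex (rshift _ (rshift _ i)) = (v3, i)).
Proof.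
do !split.
- by rewrite /block_vertex (unsplitK (inl _)) (unsplitK (inl _)).
- by rewrite /block_vertex (unsplitK (inl _)) (unsplitK (inr _)).
- by rewrite /block_vertex (unsplitK (inr _)) (unsplitK (inl _)).
- by rewrite /block_vertex (unsplitK (inr _)) (unsplitK (inr _)).
Qed.

Lemma block_vertex_bij : bijective block_vertex.
Proof.
apply: inj_card_bij; last by rewrite card_prod !card_ord; lia.
move=> k l; case: (split_ordP k) => k1 ->; case: (split_ordP k1) => i ->;
  case: (split_ordP l) => l1 ->; case: (split_ordP l1) => j ->;
  by rewrite !block_vertexE => -[] // ->.
Qed.

(** The shifts 0, 2, 2, 4 are the Laplacian eigenvalues of the 4-cycle. *)
Lemma forest_sum_C4_cycle (a : R) :
  forest_sum (cartesian_adj (@cycle_adj 4) (@cycle_adj n)) a 1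
    = forest_sum (@cycle_adj n) a 1 * forest_sum (@cycle_adj n) (a + 2) 1 ^+ 2
      * forest_sum (@cycle_adj n) (a + 4) 1.
Proof.
(* Diagonal block of one copy of the cycle; 4 is the degree of a vertex in the product. *)
pose A : 'M[R]_n := (a + 4)%:M - (shift_mx R n + (shift_mx R n)^T).
pose I : 'M[R]_n := 1%:M.
rewrite -(det_laplacian _ block_vertex_bij).
transitivity (\det (block_mx (block_mx A (- I) (- I) A)
   (block_mx 0 (- I) (- I) 0) (block_mx 0 (- I) (- I) 0)
   (block_mx A (- I) (- I) A))).
  congr (\det _); apply/matrixP => k l.
  rewrite mxE sum_cartesian_adj; last exact: cycle_adj_irrefl.
  rewrite !sum_cycle_adj //.
  have ordS4 : (ordS v0 = v1) * (ordS v1 = v2) * (ordS v2 = v3) * (ordS v3 = v0).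
    by do !split; apply: val_inj.
  have ord_pred4 : (ord_pred v0 = v3) * (ord_pred v1 = v0) * (ord_pred v2 = v1)
      * (ord_pred v3 = v2) by do !split; apply: val_inj.
  case: (split_ordP k) => k1 ->; case: (split_ordP k1) => i ->;
    case: (split_ordP l) => l1 ->; case: (split_ordP l1) => j ->;
    rewrite !block_vertexE !(block_mxEul, block_mxEur, block_mxEdl, block_mxEdr) /=
      ?(ordS4, ord_pred4) ?xpair_eqE ?eqxx /= /A /I !mxE;
    rewrite ?[ordS i == j]eq_sym ?[ord_pred i == j]eq_sym -?eq_ordS
      -?[(a + 4) *+ _]mulr_natr; ring.
(* The sum of the outer blocks is again circulant and yields [A - 2I] and [A + 2I]; their difference
   is block diagonal and yields [A] twice. *)
rewrite det_block_mx_circulant.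
rewrite opp_block_mx !add_block_mx oppr0 !addr0 opprK addNr.
rewrite det_block_mx_circulant det_ublock !forest_sum_cycle // !scale1r.
have -> : A + (- I - I) = (a + 1 *+ 2)%:M - (shift_mx R n + (shift_mx R n)^T).
  by apply/matrixP => i j; rewrite /A /I !mxE -[(a + 4) *+ _]mulr_natr
    -[(a + _) *+ _]mulr_natr; ring.
have -> : A - (- I - I) = (a + 4 + 1 *+ 2)%:M - (shift_mx R n + (shift_mx R n)^T).
  by apply/matrixP => i j; rewrite /A /I !mxE -[(a + 4) *+ _]mulr_natr
    -[(a + 4 + _) *+ _]mulr_natr; ring.
have -> : a + 2 + 1 *+ 2 = a + 4 by ring.
by rewrite -/A; ring.
Qed.

End C4Product.

(** Coefficients of ['X] are compared in the factorization. The first factor has no constant term,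
    so the other factors enter only through their values at 0. *)
Lemma num_spanning_trees_C4_cycle (R : idomainType) n : (3 <= n)%N ->
  (4 * n)%:R * (num_spanning_trees (cartesian_adj (@cycle_adj 4) (@cycle_adj n)))%:R
  = n%:R ^+ 2 * forest_sum (@cycle_adj n) (2 : R) 1 ^+ 2 * forest_sum (@cycle_adj n) 4 1.
Proof.
move=> n3; have n0 : (0 < #|'I_n|)%N by rewrite card_ord; lia.
have := @forest_sum_C4_cycle {poly R} n n3 'X => /(congr1 (coefp 1)) /=.
rewrite coef1_forest_sum /num_rooted_spanning_trees card_rooted_spanning_trees.
- rewrite card_prod !card_ord natrM => ->.
  rewrite -mulrA coefM !big_ord_recl big_ord0 /= coef0_forest_sum // mul0r add0r addr0.
  rewrite coef1_forest_sum num_rooted_spanning_trees_cycle // natrX -mulrA.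
  rewrite -horner_coef0 hornerM horner_exp.
  have H c : (forest_sum (@cycle_adj n) ('X + c%:R) 1 : {poly R}).[0]
     = forest_sum (@cycle_adj n) c%:R 1.
    rewrite -[LHS]/(horner_eval 0 _) rmorph_forest_sum /= /horner_eval.
    by rewrite hornerD hornerX hornerMn !hornerC add0r.
  by rewrite !H.
- by apply: cartesian_adj_irrefl; apply: cycle_adj_irrefl; lia.
- by apply: cartesian_adj_sym; apply: cycle_adj_sym.
Qed.

(** [P] and [Q] play the roles of $\sqrt{c}\,w^{n/2}$ and $\sqrt{c}\,w^{-n/2}$, without half powers
    in the field. The free factor [c] lets one lemma serve both real powers and the explicit
    radicals. *)
Lemma forest_sum_cycle_closed (R : fieldType) n (m w c P Q : R) : (3 <= n)%N ->
  (w - 1) ^+ 2 = w * m -> w != 0 -> c != 0 -> P * Q = c -> P ^+ 2 = c * w ^+ n ->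
  c * forest_sum (@cycle_adj n) m 1 = (P - Q) ^+ 2.
Proof.
move=> n3 wm w0 c0 PQ PP.
have P0 : P ^+ 2 != 0 by rewrite PP mulf_neq0 ?expf_neq0.
have := forest_sum_cycle_sqr w n3; rewrite wm -[X in forest_sum _ _ X]mulr1.
rewrite forest_sum_homog card_ord => E; apply: (mulfI P0).
have -> : P ^+ 2 * (P - Q) ^+ 2 = (P ^+ 2 - P * Q) ^+ 2 by ring.
rewrite PQ PP -[X in _ = (_ - X) ^+ 2]mulr1 -mulrBr exprMn -E; ring.
Qed.

(** * Forest sums of the cycle in terms of [alpha], [beta] and [u_] *)

Section ClosedForm.
Variable R : realType.

Lemma sqr_powR_half (a : R) n : 0 <= a -> (a `^ (n%:R / 2)) ^+ 2 = a ^+ n.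
Proof.
by move=> a0; rewrite -powR_mulrn ?powR_ge0 // -powRrM divfK ?pnatr_eq0 // powR_mulrn.
Qed.

Variable m : nat.
Hypothesis m0 : (0 < m)%N.

Let disc : R := m%:R ^+ 2 + 4 * m%:R.

Lemma alpha_beta : alpha R m * beta R m = 1.
Proof.
have d0 : 0 <= disc by rewrite addr_ge0 ?mulr_ge0 ?exprn_ge0 ?ler0n.
have := sqr_sqrtr d0; rewrite /alpha /beta -/disc => E.
have -> : (m%:R + 2 + Num.sqrt disc) / 2 * ((m%:R + 2 - Num.sqrt disc) / 2)
  = ((m%:R + 2) ^+ 2 - Num.sqrt disc ^+ 2) / 4 by field.
by rewrite E /disc; field.
Qed.

Lemma alpha_gt0 : 0 < alpha R m.
Proof.
by rewrite /alpha divr_gt0 // ltr_wpDr ?sqrtr_ge0 // ltr_wpDl ?ler0n.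
Qed.

Lemma beta_gt0 : 0 < beta R m.
Proof. by rewrite -(pmulr_rgt0 _ alpha_gt0) alpha_beta. Qed.

Lemma alphaB1_sqr : (alpha R m - 1) ^+ 2 = alpha R m * m%:R.
Proof.
have -> : (alpha R m - 1) ^+ 2
  = alpha R m * (alpha R m + beta R m - 2) + (1 - alpha R m * beta R m) by ring.
by rewrite alpha_beta subrr addr0; congr (_ * _); rewrite /alpha /beta; field.
Qed.

Lemma alphaBbeta_sqr : (alpha R m - beta R m) ^+ 2 = m%:R ^+ 2 + 4 * m%:R.
Proof.
have d0 : 0 <= disc by rewrite addr_ge0 ?mulr_ge0 ?exprn_ge0 ?ler0n.
have -> : alpha R m - beta R m = Num.sqrt disc by rewrite /alpha /beta -/disc; field.
exact: sqr_sqrtr.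
Qed.

(** Here [c = 1], with half powers of [alpha] and [beta] as [P] and [Q]; the prefactor is the
    squared denominator of [u_]. *)
Lemma forest_sum_cycle_u n : (3 <= n)%N ->
  forest_sum (@cycle_adj n) (m%:R : R) 1
    = (m%:R ^+ 2 + 4 * m%:R) * u_ (n%:R / 2) m ^+ 2.
Proof.
move=> n3; have a0 := alpha_gt0; have b0 := beta_gt0.
have d0 : (alpha R m - beta R m) ^+ 2 != 0.
  rewrite alphaBbeta_sqr gt_eqF // ltr_wpDl ?exprn_ge0 ?ler0n //.
  by rewrite mulr_gt0 ?ltr0n.
rewrite /u_ exprMn exprVn -alphaBbeta_sqr mulrC divfK // -[LHS]mul1r.
apply: (@forest_sum_cycle_closed _ _ _ (alpha R m)) => //.
- exact: alphaB1_sqr.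
- by rewrite gt_eqF.
- exact: oner_neq0.
- by rewrite -powRM ?ltW // alpha_beta powR1.
- by rewrite mul1r sqr_powR_half // ltW.
Qed.

End ClosedForm.

Theorem theorem5p3 (R : realType) (n : nat) (hn : (3 <= n)%N) :
  (num_spanning_trees (cartesian_adj (@cycle_adj 4) (@cycle_adj n)))%:R
    = 2 ^+ 7 * 3 ^+ 2 * n%:R * e_ (n%:R / 2 : R) ^+ 4 * f_ (n%:R / 2 : R) ^+ 2
  /\
  2 ^+ 7 * 3 ^+ 2 * n%:R * e_ (n%:R / 2 : R) ^+ 4 * f_ (n%:R / 2 : R) ^+ 2
    = n%:R / 4 ^+ n.+1
      * ((Num.sqrt 3 + 1) ^+ n - (Num.sqrt 3 - 1) ^+ n) ^+ 4
      * ((Num.sqrt 2 + 1) ^+ n - (Num.sqrt 2 - 1) ^+ n) ^+ 2.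
Proof.
(* The constants 12 and 32 are $m^2+4m$ at $m=2$ and $m=4$; then $12^2\cdot 32/4=2^7 3^2$. *)
have C2 : forest_sum (@cycle_adj n) (2 : R) 1 = 12 * e_ (n%:R / 2) ^+ 2.
  by rewrite (@forest_sum_cycle_u R 2) //; congr (_ * _); ring.
have C4 : forest_sum (@cycle_adj n) (4 : R) 1 = 32 * f_ (n%:R / 2) ^+ 2.
  by rewrite (@forest_sum_cycle_u R 4) //; congr (_ * _); ring.
split.
  have c0 : (4 * n)%:R != 0 :> R by rewrite pnatr_eq0; lia.
  by apply: (mulfI c0); rewrite num_spanning_trees_C4_cycle // C2 C4 natrM; ring.
have nz2 : 2 != 0 :> R by rewrite pnatr_eq0.
have sqrt2 : Num.sqrt 2 ^+ 2 = 2 :> R by rewrite sqr_sqrtr.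
have sqrt3 : Num.sqrt 3 ^+ 2 = 3 :> R by rewrite sqr_sqrtr.
(* Here $w=2+\sqrt3=\alpha(2)$. Since $(\sqrt3+1)^2=2w$ and $(\sqrt3+1)(\sqrt3-1)=2$, the factor [c]
   is [2 ^+ n]. *)
have D2 : 2 ^+ n * (12 * e_ (n%:R / 2) ^+ 2)
    = ((Num.sqrt 3 + 1) ^+ n - (Num.sqrt 3 - 1) ^+ n) ^+ 2 :> R.
  rewrite -C2; apply: (@forest_sum_cycle_closed _ _ _ (2 + Num.sqrt 3)) => //.
  - by ring: sqrt3.
  - by rewrite gt_eqF // ltr_wpDr ?sqrtr_ge0.
  - by rewrite expf_neq0.
  - by rewrite -exprMn; congr (_ ^+ _); ring: sqrt3.
  - by rewrite -exprM mulnC exprM -exprMn; congr (_ ^+ _); ring: sqrt3.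
(* Here $w=3+2\sqrt2=\alpha(4)=(\sqrt2+1)^2$ and $(\sqrt2+1)(\sqrt2-1)=1$, so [c] is 1. *)
have D4 : 32 * f_ (n%:R / 2) ^+ 2
    = ((Num.sqrt 2 + 1) ^+ n - (Num.sqrt 2 - 1) ^+ n) ^+ 2 :> R.
  rewrite -C4 -[LHS]mul1r.
  apply: (@forest_sum_cycle_closed _ _ _ (3 + 2 * Num.sqrt 2)) => //.
  - by ring: sqrt2.
  - by rewrite gt_eqF // ltr_wpDr ?mulr_ge0 ?sqrtr_ge0.
  - exact: oner_neq0.
  - by rewrite -exprMn -[RHS](expr1n _ n); congr (_ ^+ _); ring: sqrt2.
  - by rewrite -exprM mulnC exprM mul1r; congr (_ ^+ _); ring: sqrt2.
rewrite -D4 (exprM (_ - _) 2 2) -D2 [4 ^+ n.+1]exprS.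
have -> : 4 ^+ n = 2 ^+ n * 2 ^+ n :> R by rewrite -exprMn; congr (_ ^+ _); ring.
have z0 : 2 ^+ n != 0 :> R by rewrite expf_neq0.
by field.
Qed.
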